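(* Let $\gamma$ be a real number and $c\ge 0$ a constant such that for every instance of ROLDARP, $\mathrm{OPT}'\le \gamma\cdot\mathrm{rev}(\mathrm{SBP})+c$, where $\mathrm{rev}(\mathrm{SBP})$ is the total revenue earned by the algorithm SBP and $\mathrm{OPT}'$ is the maximum revenue an offline schedule can earn from requests it completes within the first $T-2T/f$ time units (i.e. the revenue of the optimal offline solution excluding the last two time segments). Then $\gamma\ge 5$. (More precisely, for every even integer $f>2$ there are instances for which the ratio $\mathrm{OPT}'/\mathrm{rev}(\mathrm{SBP})$ is arbitrarily close to $5-4/(f-2)$.)
   Context: ROLDARP: an instance consists of a complete undirected graph $G=(V,E)$ with positive edge weights $w(u,v)$ (travel times), an origin $o\in V$, a time limit $T>0$, an integer $f$ with $1<f<T$ such that every edge weight is at most $T/f$, and a sequence of requests $(s,d,t,p)$ (source, destination, release time $t\ge0$, revenue $p>0$). A unit-capacity server starts at $o$ at time $0$; serving a request means travelling to $s$ and then from $s$ to $d$, starting from $s$ no earlier than $t$; at most one request is carried at a time, service is non-preemptive, and revenue $p$ is earned if the request is completed by time $T$. Requests become known to an online algorithm at their release times. Time is split into $f$ segments $t_1,\dots,t_f$ of length $T/f$, where $t_j$ ends at time $jT/f$. Algorithm SBP (Segmented Best Path): if $f$ is odd, it stays idle during $t_1$ and sets $i=2$; otherwise $i=1$. While $i<f$: at the start of segment $t_i$ it computes a max-revenue-request-set $R$, namely, among requests released by that time and not yet served, a sequence of requests $r_1,\dots,r_\ell$ that can be served consecutively (serve $r_1$, travel from the destination of $r_1$ to the source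 of $r_2$, serve $r_2$, etc.) starting at the source of $r_1$ within total time at most $T/f$, of maximum total revenue. If $R$ is non-empty it moves to the source of $r_1$ during $t_i$ and serves $R$ during $t_{i+1}$; otherwise it stays idle during $t_i$ and $t_{i+1}$. Then $i$ is increased by $2$. *)

(* Defs.v *)
From HB Require Import structures.
From mathcomp Require Import all_boot all_order all_algebra.
From mathcomp Require Import boolp classical_sets reals.

Set Implicit Arguments.
Unset Strict Implicit.
Unset Printing Implicit Defensive.

Import Order.TTheory GRing.Theory Num.Theory.
Local Open Scope ring_scope.

Record request (R : realType) (V : finType) := Request {
  source : V;
  dest : V;
  release : R;
  revenue : R;
  release_ge0 : 0 <= release;
  revenue_gt0 : 0 < revenue
}.

(* The complete graph has no loops; the diagonal of [weight] only encodes that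
   staying put takes no time. The weights need not satisfy the triangle
   inequality. Requests are indexed, so identical requests may occur. *)
Record instance (R : realType) := Instance {
  vertex : finType;
  weight : vertex -> vertex -> R;
  origin : vertex;
  horizon : R;
  nseg : nat;
  nreq : nat;
  req : 'I_nreq -> request R vertex;
  weight_sym : forall u v, weight u v = weight v u;
  weight_diag : forall u, weight u u = 0;
  weight_gt0 : forall u v, u != v -> 0 < weight u v;
  horizon_gt0 : 0 < horizon;
  nseg_gt1 : (1 < nseg)%N;
  nseg_lt : nseg%:R < horizon;
  weight_le : forall u v, weight u v <= horizon / nseg%:R
}.

Section Dialaride.
Variables (R : realType) (I : instance R).
Implicit Types (u v : vertex I) (i : 'I_(nreq I)) (B : seq 'I_(nreq I)).

Definition src i := source (req i).
Definition dst i := dest (req i).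
Definition rtime i := release (req i).
Definition gain i := revenue (req i).

Fixpoint walk_time u (p : seq (vertex I)) : R :=
  if p is v :: p' then weight u v + walk_time v p' else 0.

(* Least time needed to go from u to v along edges of the graph; it is
   [weight u v] when the weights satisfy the triangle inequality. *)
Definition dist u v : R :=
  inf [set tau | exists2 p, last u p = v & walk_time u p = tau].

(* The pairs (request, time at which the server leaves its source with it),
   in order of service. *)
Definition schedule := seq ('I_(nreq I) * R).

Definition completion (x : 'I_(nreq I) * R) : R :=
  x.2 + dist (src x.1) (dst x.1).

(* A server located at v at time tau can carry out S. *)
Fixpoint executable v (tau : R) (S : schedule) : Prop :=
  if S is x :: S' then
    [/\ tau + dist v (src x.1) <= x.2, rtime x.1 <= x.2
      & executable (dst x.1) (completion x) S']
  else True.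

Definition feasible (S : schedule) : Prop :=
  uniq (map fst S) /\ executable (origin I) 0 S.

Definition done_by (D : R) (S : schedule) : {set 'I_(nreq I)} :=
  [set:: [seq x.1 | x <- S & completion x <= D]].

Definition earned_by (D : R) (S : schedule) : R :=
  \sum_(i in done_by D S) gain i.

Definition seglen : R := horizon I / (nseg I)%:R.

(* Optimal offline revenue from the requests completed before the last two
   segments. The maximum is taken over the finitely many sets of requests that
   some feasible schedule completes by then (the empty set is one of them). *)
Definition OPT' : R :=
  \big[Order.max/0]_(A : {set 'I_(nreq I)} |
      `[< exists2 S, feasible S & A = done_by (horizon I - 2 * seglen) S >])
    \sum_(i in A) gain i.

(* [serve v a B]: from v at time a, serve the requests of B consecutively
   without waiting; [serve_time v B] is the time this takes. *)
Fixpoint serve v (a : R) B : schedule :=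
  if B is i :: B' then
    let b := a + dist v (src i) in
    (i, b) :: serve (dst i) (b + dist (src i) (dst i)) B'
  else [::].

Fixpoint serve_time v B : R :=
  if B is i :: B' then
    dist v (src i) + dist (src i) (dst i) + serve_time (dst i) B'
  else 0.

Definition batch_serve (a : R) B : schedule :=
  if B is i :: _ then serve (src i) a B else [::].

Definition batch_time B : R :=
  if B is i :: _ then serve_time (src i) B else 0.

Definition batch_revenue B : R := \sum_(i <- B) gain i.

(* The sequences of requests that the algorithm may select at time tau when
   the requests in [served] have been served. *)
Definition candidate (tau : R) (served : {set 'I_(nreq I)}) B : Prop :=
  [/\ uniq B, {in B, forall i, rtime i <= tau /\ i \notin served}
    & batch_time B <= seglen].

Definition max_revenue_request_set tau served B : Prop :=
  candidate tau served B /\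
  forall B', candidate tau served B' -> batch_revenue B' <= batch_revenue B.

(* [SBP_loop j served S]: from the start of segment t_j, at time
   (j - 1) * seglen, the loop can produce the schedule S. It is a relation
   because the max-revenue-request-set need not be unique. The set selected at
   the start of t_j is served from time j * seglen on: every distance is at most
   seglen, so t_j suffices to reach its first source. *)
Inductive SBP_loop : nat -> {set 'I_(nreq I)} -> schedule -> Prop :=
| SBP_stop (j : nat) served : (nseg I <= j)%N -> SBP_loop j served [::]
| SBP_step (j : nat) served B S : (j < nseg I)%N ->
    max_revenue_request_set (j.-1%:R * seglen) served B ->
    SBP_loop j.+2 (served :|: [set:: B]) S ->
    SBP_loop j served (batch_serve (j%:R * seglen) B ++ S).

Definition SBP_run (S : schedule) : Prop :=
  SBP_loop (if odd (nseg I) then 2 else 1) finset.set0 S.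

Lemma dist_bounds u v : 0 <= dist u v <= seglen.
Proof.
have walk_ge0 x p : 0 <= walk_time x p.
  elim: p x => //= y p IH x; rewrite addr_ge0 //.
  by have [->|/weight_gt0/ltW//] := eqVneq x y; rewrite weight_diag.
apply/andP; split.
  apply: lb_le_inf; first by exists (weight u v + 0), [:: v].
  by move=> _ [p _ <-].
apply: le_trans (weight_le u v); apply: ge_inf.
  by exists 0 => _ [p _ <-].
by exists [:: v] => //=; rewrite addr0.
Qed.

Lemma seglen_gt0 : 0 < seglen.
Proof.
by rewrite divr_gt0 ?horizon_gt0 // ltr0n (leq_trans _ (nseg_gt1 I)).
Qed.

Lemma max_revenue_request_set_ex tau served :
  exists B, max_revenue_request_set tau served B.
Proof.
pose P (A : {set 'I_(nreq I)}) :=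
  `[< exists2 B, candidate tau served B & A = [set:: B] >].
have revE B : uniq B -> batch_revenue B = \sum_(i in [set:: B]) gain i.
  move=> uB; rewrite /batch_revenue big_uniq //.
  by apply: eq_bigl => i; rewrite inE.
have P0 : P finset.set0.
  apply/asboolP; exists [::]; last by apply/setP => i; rewrite !inE.
  by split=> //=; rewrite ltW ?seglen_gt0.
case: (arg_maxP (fun A : {set 'I_(nreq I)} => \sum_(i in A) gain i) P0).
move=> A /asboolP[B cB ->] maxB; exists B; split=> // B' cB'.
case: (cB) (cB') => uB _ _ [uB' _ _]; rewrite !revE //.
by apply: maxB; apply/asboolP; exists B'.
Qed.

(* The algorithm always has a run. *)
Lemma SBP_run_ex : exists S, SBP_run S.
Proof.
suff loop k (j : nat) served :
    (nseg I <= j + k)%N -> exists S, SBP_loop j served S.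
  exact: (loop (nseg I) _ _ (leq_addl _ _)).
elim: k j served => [|k IH] j served.
  by rewrite addn0 => ?; exists [::]; constructor.
move=> le_k; have [?|lt_j] := leqP (nseg I) j; first by exists [::]; constructor.
have [B HB] := max_revenue_request_set_ex (j.-1%:R * seglen) served.
have [|S HS] := IH j.+2 (served :|: [set:: B]).
  by rewrite (leq_trans le_k) // !addSn addnS ltnW.
by eexists; apply: SBP_step HB HS.
Qed.

End Dialaride.

(* Main.v *)
Require Import Defs.
From HB Require Import structures.
From mathcomp Require Import all_boot all_order all_algebra.
From mathcomp Require Import boolp classical_sets reals.
From mathcomp Require Import ring lra zify.

Set Implicit Arguments.
Unset Strict Implicit.
Unset Printing Implicit Defensive.

Import Order.TTheory GRing.Theory Num.Theory.
Local Open Scope ring_scope.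

(* Write f = 2m + 2 and L = T/f. Three vertices, two shuttle ends and a hub, are
   pairwise at distance l slightly above L/2. The shuttle carries 4m - 2 requests
   of revenue p < 1, alternately in each direction, all released just after time
   0; the hub carries m requests of revenue 1 that start and end there, the j-th
   being released between the j-th and the (j+1)-st decision of SBP. Two requests
   that are not both at the hub take at least 2l > L, so each decision of SBP but
   the first one, at which nothing has been released, selects the single hub
   request not yet served: SBP earns m. Offline, the whole shuttle sequence fits
   before time T - 2L, with just enough time left to reach the hub, where all m
   requests are then served at once: OPT' = m + (4m - 2)p. The ratio tends to
   5 - 2/m = 5 - 4/(f - 2) as p tends to 1. *)

(** * Distances and the offline optimum in an arbitrary instance *)

Section GeneralInstance.
Variables (R : realType) (I : instance R).

Lemma dist_weight (u v : vertex I) :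
  (forall x y z : vertex I, weight x z <= weight x y + weight y z) ->
  dist u v = weight u v.
Proof.
move=> tri; have walk_ge p (x y : vertex I) :
    last x p = y -> weight x y <= walk_time x p.
  elim: p x => [|z p IH] x /=; first by move<-; rewrite weight_diag.
  by move=> /IH zy; apply: le_trans (tri x z y) _; rewrite lerD2l.
apply/eqP; rewrite eq_le; apply/andP; split.
  apply: ge_inf; last by exists [:: v] => //=; rewrite addr0.
  by exists (weight u v) => _ [p up <-]; exact: walk_ge.
apply: lb_le_inf; first by exists (weight u v + 0), [:: v].
by move=> _ [p up <-]; exact: walk_ge.
Qed.

Lemma gain_ge0 (i : 'I_(nreq I)) : 0 <= gain i.
Proof. exact: ltW (revenue_gt0 _). Qed.

Lemma serve_time_ge0 (B : seq 'I_(nreq I)) (v : vertex I) : 0 <= serve_time v B.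
Proof.
elim: B v => //= i B IH v; rewrite !addr_ge0 //.
- by have /andP[] := dist_bounds v (src i).
- by have /andP[] := dist_bounds (src i) (dst i).
Qed.

Lemma done_by_cat (D : R) (S1 S2 : schedule I) :
  done_by D (S1 ++ S2) = done_by D S1 :|: done_by D S2.
Proof. by apply/setP=> i; rewrite !inE filter_cat map_cat mem_cat. Qed.

(** Revenues are nonnegative, so no set of requests earns more than all of them together; [S]
    attains this bound. *)
Lemma OPT'_all (S : schedule I) : feasible S ->
  done_by (horizon I - 2 * seglen I) S = [set: 'I_(nreq I)]%SET ->
  OPT' I = \sum_(i < nreq I) gain i.
Proof.
move=> feS dS; apply/eqP; rewrite eq_le; apply/andP; split.
  apply/bigmax_leP; split=> [|A _].
    by apply: sumr_ge0 => i _; exact: gain_ge0.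
  rewrite [leRHS](bigID (mem A)) /= lerDl.
  by apply: sumr_ge0 => i _; exact: gain_ge0.
have -> : \sum_(i < nreq I) gain i = \sum_(i in [set: 'I_(nreq I)]%SET) gain i.
  by apply: eq_bigl => i; rewrite inE.
apply: (@le_bigmax_cond _ _ _ _ _ _
  (fun A : {set 'I_(nreq I)} => \sum_(i in A) gain i)).
by apply/asboolP; exists S.
Qed.

End GeneralInstance.

(** * The shuttle-and-hub instance *)

Section LowerBound.
Variables (R : realType) (n : nat) (p : R).
Hypothesis p_gt0 : 0 < p.

(* With L = 8m, l = 4m + 1 and shuttle requests released at time 1, the offline
   server reaches the hub at time 1 + (4m - 1) l = 2mL = T - 2L exactly. *)
Local Notation m := n.+1.
Local Notation L := (8 * m)%N.
Local Notation l := (4 * m).+1.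
Local Notation N := (4 * n).+2.

(* [None] is the hub, [Some false] and [Some true] the ends of the shuttle. *)
Definition lb_weight (u v : option bool) : R := if u == v then 0 else l%:R.

Lemma lb_weight_sym u v : lb_weight u v = lb_weight v u.
Proof. by rewrite /lb_weight eq_sym. Qed.

Lemma lb_weight_diag u : lb_weight u u = 0.
Proof. by rewrite /lb_weight eqxx. Qed.

Lemma lb_weight_gt0 u v : u != v -> 0 < lb_weight u v.
Proof. by rewrite /lb_weight => /negPf->; rewrite ltr0n. Qed.

Lemma lb_weight_triangle u v w : lb_weight u w <= lb_weight u v + lb_weight v w.
Proof.
have l0 : 0 <= l%:R :> R by exact: ler0n.
rewrite /lb_weight; case: (eqVneq u v) => [->|_]; first by rewrite add0r.
by case: ifP => _; case: ifP => _; lra.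
Qed.

(** The parity of [i] sets the direction, so each request starts where its predecessor ends. *)
Definition shuttle_request (i : 'I_N) : request R (option bool) :=
  @Request R _ (Some (odd i)) (Some (~~ odd i)) 1 p ler01 p_gt0.

Definition hub_request (j : 'I_m) : request R (option bool) :=
  @Request R _ None None (j.*2.+1 * L)%:R 1 (ler0n _ _) ltr01.

Definition lb_request (i : 'I_(N + m)) : request R (option bool) :=
  match fintype.split i with inl a => shuttle_request a | inr b => hub_request b end.

Local Notation f := m.*2.+2.

Lemma lb_horizon_gt0 : 0 < (f * L)%:R :> R.
Proof. by rewrite ltr0n; lia. Qed.

Lemma lb_nseg_lt : f%:R < (f * L)%:R :> R.
Proof. by rewrite ltr_nat; lia. Qed.

Lemma lb_weight_le u v : lb_weight u v <= (f * L)%:R / f%:R.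
Proof.
rewrite natrM mulrAC divff ?pnatr_eq0 // mul1r /lb_weight.
by case: ifP => _; rewrite ?ler0n // ler_nat; lia.
Qed.

Definition lb_instance : instance R :=
  @Instance R (option bool) lb_weight (Some false) (f * L)%:R f (N + m) lb_request
    lb_weight_sym lb_weight_diag lb_weight_gt0 lb_horizon_gt0 isT lb_nseg_lt
    lb_weight_le.

Local Notation I := lb_instance.

Definition shuttle (i : 'I_N) : 'I_(nreq I) := lshift m i.
Definition hub (j : 'I_m) : 'I_(nreq I) := rshift N j.

Lemma lb_seglen : seglen I = L%:R.
Proof. by rewrite /seglen /= natrM mulrAC divff ?pnatr_eq0 // mul1r. Qed.

Lemma lb_dist (u v : vertex I) : dist u v = if u == v then 0 else l%:R.
Proof. exact/dist_weight/lb_weight_triangle. Qed.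

Lemma lb_indexP (i : 'I_(nreq I)) :
  (exists a, i = shuttle a) \/ (exists b, i = hub b).
Proof. by case: (split_ordP (i : 'I_(N + m))) => a ->; [left|right]; exists a. Qed.

Lemma req_shuttle a : req (shuttle a) = shuttle_request a.
Proof. by rewrite /= /lb_request /shuttle (unsplitK (inl a)). Qed.

Lemma req_hub b : req (hub b) = hub_request b.
Proof. by rewrite /= /lb_request /hub (unsplitK (inr b)). Qed.

Definition lbE := (req_shuttle, req_hub, lb_dist, lb_seglen).

Lemma dist_shuttle a : dist (src (shuttle a)) (dst (shuttle a)) = l%:R.
Proof. by rewrite /src /dst !lbE /=; case: (odd a). Qed.

Lemma dist_shuttle_hub a b : dist (dst (shuttle a)) (src (hub b)) = l%:R.
Proof. by rewrite /src /dst !lbE. Qed.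

Lemma dist_hub_shuttle b a : dist (dst (hub b)) (src (shuttle a)) = l%:R.
Proof. by rewrite /src /dst !lbE. Qed.

(** Either there are two shuttle rides, or one ride and an empty trip between the shuttle and the
    hub; both take 2l = 8m + 2 > 8m. *)
Lemma lb_batch_time_gt (i j : 'I_(nreq I)) (B : seq 'I_(nreq I)) :
  (exists a, i = shuttle a) \/ (exists a, j = shuttle a) ->
  L%:R < batch_time [:: i, j & B].
Proof.
move=> sh; have L2l : L%:R < l%:R + l%:R :> R by rewrite -natrD ltr_nat; lia.
apply: lt_le_trans L2l _.
rewrite -[leRHS]/(_ + _ + (_ + _ + serve_time (dst j) B)).
have ge0 u v : 0 <= dist (u : vertex I) v by have /andP[] := dist_bounds u v.
have B0 := serve_time_ge0 B (dst j).
have [] := (ge0 (src i) (src i), ge0 (src i) (dst i)).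
have [] := (ge0 (dst i) (src j), ge0 (src j) (dst j)).
case: (lb_indexP i) (lb_indexP j) => -[a ei] [] [b ej]; subst i j; last first.
- by case: sh => -[c] /(congr1 val) /=; move: (ltn_ord c); lia.
all: rewrite ?dist_shuttle ?dist_shuttle_hub ?dist_hub_shuttle => *; lra.
Qed.

Lemma hub_inj : injective hub.
Proof. exact: rshift_inj. Qed.

(** * The offline schedule and its revenue *)

Definition opt_shuttles (s : seq 'I_N) : schedule I :=
  [seq (shuttle i, (1 + i * l)%:R) | i <- s].

Definition opt_hubs : schedule I :=
  [seq (hub j, (m.*2 * L)%:R) | j <- enum 'I_m].

Lemma opt_hubs_executable (v : vertex I) (tau : R) :
  tau + dist v None <= (m.*2 * L)%:R -> executable v tau opt_hubs.
Proof.
rewrite /opt_hubs; elim: (enum 'I_m) v tau => //= j s IH v tau tv.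
rewrite /src /dst /rtime /completion !req_hub /=; split=> //.
  by rewrite ler_nat leq_pmul2r //; have := ltn_ord j; lia.
by apply: IH; rewrite /src /dst req_hub !lb_dist /= !addr0.
Qed.

(** After k rides the server stands at the end [odd k], no later than 1 + kl. The induction is on
    the number N - k of rides left. *)
Lemma opt_shuttles_executable k (tau : R) : (k <= N)%N -> tau <= (1 + k * l)%:R ->
  executable (Some (odd k) : vertex I) tau
    (opt_shuttles (drop k (enum 'I_N)) ++ opt_hubs).
Proof.
move: {2}(N - k)%N (erefl (N - k)%N) => d; elim: d k tau => [|d IH] k tau ed kN tauk.
  have -> : k = N by lia.
  rewrite drop_oversize ?size_enum_ord //=; apply: opt_hubs_executable.
  (* With N + 1 = 4m - 1, this is 1 + (4m - 1)(4m + 1) = 16m^2 = 2m * 8m. *)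
  rewrite lb_dist /=; have -> : (m.*2 * L)%:R = (1 + N * l)%:R + l%:R :> R.
    by rewrite -natrD; congr _%:R; lia.
  by rewrite lerD2r; move: tauk; have -> : k = N by lia.
have lt_kN : (k < N)%N by lia.
rewrite (drop_nth (Ordinal lt_kN)) ?size_enum_ord //.
have -> : nth (Ordinal lt_kN) (enum 'I_N) k = Ordinal lt_kN.
  by apply/val_inj; rewrite /= nth_enum_ord.
rewrite /=; split.
- by rewrite /src !lbE /= eqxx addr0.
- by rewrite /rtime !lbE /= ler1n.
- rewrite {1}/dst req_shuttle /= -[~~ odd k]/(odd k.+1); apply: IH => //; first lia.
  rewrite /completion dist_shuttle /=.
  by rewrite -natrD ler_nat mulSn; lia.
Qed.

Lemma lb_OPT' : OPT' I = N%:R * p + m%:R.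
Proof.
have H : horizon I - 2 * seglen I = (m.*2 * L)%:R.
  by rewrite lb_seglen -[2]/(2%:R) -natrM /= -natrB; [congr _%:R|]; lia.
rewrite (@OPT'_all _ _ (opt_shuttles (enum 'I_N) ++ opt_hubs)).
- rewrite big_split_ord /=; congr (_ + _).
    under eq_bigr do rewrite -/(shuttle _) /gain req_shuttle /=.
    by rewrite sumr_const card_ord mulr_natl.
  under eq_bigr do rewrite -/(hub _) /gain req_hub /=.
  by rewrite sumr_const card_ord.
- split.
    rewrite map_cat -(map_comp _ _ (enum 'I_N)) -(map_comp _ _ (enum 'I_m)).
    rewrite cat_uniq (map_inj_uniq hub_inj).
    rewrite (@map_inj_uniq _ _ shuttle) ?enum_uniq ?andbT /=; last exact: lshift_inj.
    apply/hasPn=> _ /mapP[j _ ->]; apply/mapP=> -[a _] /(congr1 val) /=.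
    by have := ltn_ord a; lia.
  have := @opt_shuttles_executable 0 0 isT (ler0n _ _).
  by rewrite drop0.
- rewrite H; apply/setP=> i; rewrite done_by_cat !inE.
  case: (lb_indexP i) => -[a ->]; apply/orP; [left|right]; apply/mapP.
    exists (shuttle a, (1 + a * l)%:R) => //; rewrite mem_filter.
    rewrite map_f ?mem_enum // andbT /completion dist_shuttle /=.
    rewrite -natrD ler_nat.
    have : (a.+1 * l <= N * l)%N by rewrite leq_pmul2r // ltn_ord.
    by rewrite mulSn; lia.
  exists (hub a, (m.*2 * L)%:R) => //; rewrite mem_filter.
  by rewrite map_f ?mem_enum // andbT /completion /src /dst !lbE /= addr0.
Qed.

(** * The run of SBP *)

Definition hubs (t : nat) : {set 'I_(nreq I)} :=
  [set hub j | j : 'I_m & (j < t)%N]%SET.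

Definition hubs_from (t : nat) : {set 'I_(nreq I)} :=
  [set hub j | j : 'I_m & (t <= j)%N]%SET.

Lemma hubs0 : hubs 0 = finset.set0.
Proof. by apply/setP=> i; rewrite inE; apply/imsetP=> -[j]; rewrite inE. Qed.

Lemma hubsS (j : 'I_m) : hubs j :|: [set:: [:: hub j]] = hubs j.+1.
Proof.
apply/setP=> i; rewrite !inE; apply/idP/imsetP => [|[k]].
  case/orP=> [/imsetP[k]|/eqP->]; last by exists j; rewrite ?inE.
  by rewrite inE => kj ->; exists k => //; rewrite inE (ltn_trans kj).
rewrite inE ltnS leq_eqVlt => /predU1P[/val_inj->->|kj ->].
  by rewrite eqxx orbT.
by apply/orP; left; apply/imsetP; exists k; rewrite ?inE.
Qed.

Lemma hubs_fromS (j : 'I_m) : [set hub j]%SET :|: hubs_from j.+1 = hubs_from j.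
Proof.
apply/setP=> i; rewrite !inE; apply/idP/imsetP => [|[k]].
  case/orP=> [/eqP->|/imsetP[k]]; first by exists j; rewrite ?inE.
  by rewrite inE => kj ->; exists k => //; rewrite inE ltnW.
rewrite inE leq_eqVlt => /predU1P[/val_inj<-->|kj ->]; first by rewrite eqxx.
by apply/orP; right; apply/imsetP; exists k; rewrite ?inE.
Qed.

Lemma lb_select0 B : max_revenue_request_set 0 (hubs 0) B -> B = [::].
Proof.
case: B => // i B [[_ /(_ i)]]; rewrite inE eqxx => /(_ isT)[+ _] _ _.
by case: (lb_indexP i) => -[a ->]; rewrite /rtime lbE /= ?ler10 // lern0.
Qed.

Hypothesis p_lt1 : p < 1.

(** Since 2k + 1 <= 2j + 2 forces k <= j, [hub j] is the only hub request available. Two distinct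
    requests then involve the shuttle and take too long, and as a single request [hub j] wins by 1 >
    p. *)
Lemma lb_selectS (j : 'I_m) B :
  max_revenue_request_set (j.+1.*2%:R * seglen I) (hubs j) B -> B = [:: hub j].
Proof.
have hub_avail k : rtime (hub k) <= j.+1.*2%:R * seglen I ->
    hub k \notin hubs j -> k = j.
  rewrite /rtime !lbE /= -natrM ler_nat leq_pmul2r // => kj.
  rewrite mem_imset ?inE; last exact: hub_inj.
  by rewrite -leqNgt => jk; apply/val_inj => /=; lia.
have cj : candidate (j.+1.*2%:R * seglen I) (hubs j) [:: hub j].
  split=> //= [i|]; last first.
    by rewrite /src /dst !lbE /= !addr0 ler0n.
  rewrite inE => /eqP->; split.
    by rewrite /rtime !lbE /= -natrM ler_nat leq_pmul2r //; lia.
  by rewrite mem_imset ?inE ?ltnn //; exact: hub_inj.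
case: B => [|i [|k B]] [[uB aB tB]] /(_ _ cj).
- by rewrite /batch_revenue big_nil big_seq1 /gain lbE /= ler10.
- rewrite /batch_revenue !big_seq1 /gain.
  have [ri ni] := aB i (mem_head _ _).
  case: (lb_indexP i) => -[a ei]; subst i; first by rewrite !lbE /= leNgt p_lt1.
  by rewrite (hub_avail a).
move=> _; have [ri ni] := aB i (mem_head _ _).
have [|rk nk] := aB k; first by rewrite !inE eqxx orbT.
suff: L%:R < batch_time [:: i, k & B] by rewrite ltNge -lb_seglen tB.
apply: lb_batch_time_gt.
case: (lb_indexP i) => [|[a ei]]; first by left.
case: (lb_indexP k) => [|[b ek]]; first by right.
by subst; move: uB; rewrite (hub_avail a) // (hub_avail b) //= inE eqxx.
Qed.

(** Decisions are numbered by t from 0, at times 2tL. Decision 0 selects nothing and decision t > 0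
    selects hub request t - 1, hence the truncated [t.-1]. *)
Lemma lb_SBP_done k served (S : schedule I) : SBP_loop k served S ->
  forall t, k = t.*2.+1 -> served = hubs t.-1 -> (t <= m.+1)%N ->
  done_by (horizon I) S = hubs_from t.-1.
Proof.
elim=> {k served S} [k served km t ek _ tm|k served B S km selB _ IH t ek es tm].
  apply/setP=> i; rewrite !inE; apply/esym/imsetP=> -[j]; rewrite inE => tj _.
  by move: km (ltn_ord j); rewrite /= ek; lia.
subst; move: km selB IH; rewrite /=.
case: t tm => [|t] tm km /=.
  rewrite mul0r => /lb_select0-> /(_ 1%N erefl) /= -> //.
  by apply/setP=> i; rewrite !inE orbF.
have lt_tm : (t < m)%N by lia.
move=> /(@lb_selectS (Ordinal lt_tm))-> /(_ t.+2 erefl).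
rewrite -[t in hubs t]/(val (Ordinal lt_tm)) hubsS => /(_ erefl) IH.
rewrite done_by_cat IH; last lia.
rewrite -[in RHS](hubs_fromS (Ordinal lt_tm)); congr (_ :|: _).
(* The hub request starts at an odd multiple of L below T and takes no time, so it is completed by
   T. *)
apply/setP=> i; rewrite /done_by /batch_serve /=.
rewrite /completion /src /dst !lbE /= !addr0.
by rewrite -natrM ler_nat leq_pmul2r // ltnW // !inE.
Qed.

Lemma lb_earned (S : schedule I) : SBP_run S -> earned_by (horizon I) S = m%:R.
Proof.
rewrite /SBP_run /= odd_double /= => /lb_SBP_done/(_ 0%N erefl).
rewrite /earned_by hubs0 => -> //.
rewrite big_imset /=; last by move=> ? ? _ _ /hub_inj.
under eq_bigr do rewrite /gain req_hub /=.
by rewrite sumr_const (eq_card (B := 'I_m)) ?card_ord // => j; rewrite !inE.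
Qed.

End LowerBound.

(** * Choice of [p] and of the size of the instance *)

Theorem theorem2 (R : realType)
    (sbp : forall I : instance R, schedule I)
    (sbp_run : forall I : instance R, SBP_run (sbp I)) :
  (forall gamma c : R, 0 <= c ->
     (forall I : instance R,
        OPT' I <= gamma * earned_by (horizon I) (sbp I) + c) ->
     5 <= gamma) /\
  (forall f : nat, ~~ odd f -> (2 < f)%N ->
     forall eps : R, 0 < eps ->
     exists I : instance R,
       [/\ nseg I = f,
           0 < earned_by (horizon I) (sbp I)
         & `| OPT' I / earned_by (horizon I) (sbp I)
              - (5 - 4 / (f%:R - 2)) | < eps]).
Proof.
have pick_p (eps : R) : 0 < eps ->
    exists p : R, [/\ 0 < p, p < 1 & 4 * (1 - p) < eps].
  move=> e0; have e4 : 0 < 4 + eps by lra.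
  exists (4 / (4 + eps)); split; first by rewrite divr_gt0.
    by rewrite ltr_pdivrMr //; lra.
  have -> : 4 * (1 - 4 / (4 + eps)) = 4 * eps / (4 + eps) by field; lra.
  by rewrite ltr_pdivrMr //; nra.
split=> [gamma c c0 bound|f f_even f_gt2 eps e0].
  rewrite leNgt; apply/negP=> g5.
  have [|p [p0 p1 pe]] := pick_p (5 - gamma); first by rewrite subr_gt0.
  (* With x = m, the assumed bound reads (4x - 2)p + x <= gamma x + c, that is d x <= c + 2p < c +
     2; [n] is chosen so that d(n + 1) exceeds c + 2. *)
  pose d := 1 + 4 * p - gamma; have d0 : 0 < d by rewrite /d; lra.
  pose n := Num.truncn ((c + 2) / d).
  have : (c + 2) / d < n.+1%:R by exact: truncnS_gt.
  rewrite ltr_pdivrMr // => nd.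
  have := bound (lb_instance n p0); rewrite lb_OPT' (lb_earned p1) //.
  have -> : (4 * n).+2%:R = 4 * n.+1%:R - 2 :> R.
    by rewrite -!natr1 natrM; ring.
  by move: nd; rewrite /d; set x := n.+1%:R; nra.
have [p [p0 p1 pe]] := pick_p _ e0.
(* This solves f = 2m + 2 with m = n + 1; nothing is truncated, as an even f > 2 is at least 4. *)
pose n := f./2.-2; have fE : f = n.+1.*2.+2.
  by have := odd_double_half f; rewrite (negPf f_even) /n; lia.
exists (lb_instance n p0); rewrite lb_OPT' (lb_earned p1) //; split.
- by rewrite fE.
- by rewrite ltr0n.
have n0 : 0 < n.+1%:R :> R by rewrite ltr0n.
have n1 : 1 <= n.+1%:R :> R by rewrite ler1n.
have -> : f%:R - 2 = 2 * n.+1%:R :> R.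
  by rewrite fE -muln2 -!natr1 natrM -!natr1; ring.
have -> : (4 * n).+2%:R = 4 * n.+1%:R - 2 :> R by rewrite -!natr1 natrM; ring.
move: n0 n1; move: n.+1%:R => x n0 n1.
(* The deviation has absolute value at most 4(1 - p), because x >= 1 puts 4 - 2/x between 2 and
   4. *)
have -> : ((4 * x - 2) * p + x) / x - (5 - 4 / (2 * x)) = - ((1 - p) * (4 - 2 / x)).
  by field; lra.
have /andP[y0 y2] : 0 < 2 / x <= 2 by rewrite divr_gt0 //= ler_pdivrMr //; lra.
move: (2 / x) y0 y2 => y y0 y2; rewrite normrN ger0_norm; last by apply: mulr_ge0; lra.
by apply: le_lt_trans pe; rewrite [leLHS]mulrC; apply: ler_wpM2r; lra.
Qed.
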